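(* Let $\Phi:H_m\to H_n$ be a quantum channel and let $1\le\alpha<2$. Then \[ S_{\min,\alpha}(\Phi)\geq g_\alpha\left(\|\Phi\|_{1\to2}^2\right), \] and equality holds when $n=2$.
   Context: $H_n$ denotes the real space of $n\times n$ Hermitian matrices and $H_{n,+,1}$ the set of density matrices. A quantum channel is a completely positive trace-preserving linear map. $\|\Phi\|_{1\to2}=\max_{0\neq\rho\in H_m}\|\Phi(\rho)\|_2/\|\rho\|_1$, which for a channel equals $\max_{\rho\in H_{m,+,1}}\|\Phi(\rho)\|_2$. The Rényi entropy is $S_\alpha(\sigma)=\frac1{1-\alpha}\log{\rm Tr}\,\sigma^\alpha$ ($S_1$ is the von Neumann entropy $-{\rm Tr}\,\sigma\log\sigma$), and $S_{\min,\alpha}(\Phi)=\min_{\rho\in H_{m,+,1}}S_\alpha(\Phi(\rho))$. For $c\in(0,1]$ let $k=\lfloor 1/c\rfloor$ and $\Delta=\sqrt{c-(1-c)/k}$, and define $g_\alpha(c)=\frac{1}{1-\alpha}\log\left(k\left(\frac{1+\Delta}{1+k}\right)^\alpha+\left(\frac{1-k\Delta}{1+k}\right)^\alpha\right)$ for $1<\alpha<2$, and $g_1(c)=\log(k+1)-\frac{1}{1+k}\left[k(1+\Delta)\log(1+\Delta)+(1-k\Delta)\log(1-k\Delta)\right]$ (with $0\log 0=0$). *)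

(* Defs.v *)
From HB Require Import structures.
From mathcomp Require Import all_boot all_order all_algebra.
From mathcomp Require Import all_classical all_reals.
From mathcomp Require Import exp.
From mathcomp Require Import complex.
Set Implicit Arguments. Unset Strict Implicit. Unset Printing Implicit Defensive.
Import Order.TTheory GRing.Theory Num.Theory.
Local Open Scope ring_scope.
Local Open Scope classical_set_scope.

Section QInfo.
Variable R : realType.
Local Notation C := (complex R).

Definition adj (p q : nat) (A : 'M[C]_(p, q)) : 'M[C]_(q, p) :=
  (map_mx (@conjc R) A)^T.

Definition psd (p : nat) (A : 'M[C]_p) : Prop :=
  adj A = A /\ forall v : 'cV[C]_p, 0 <= (adj v *m A *m v) 0 0.

Definition density (p : nat) (A : 'M[C]_p) : Prop :=
  psd A /\ \tr A = 1.

(* positivity of a k x k block matrix X = (X i j) in M_k(M_p), written out: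
   Hermitian and nonnegative quadratic form on (C^p)^k *)
Definition block_psd (k p : nat) (X : 'I_k -> 'I_k -> 'M[C]_p) : Prop :=
  (forall i j, X j i = adj (X i j)) /\
  forall v : 'I_k -> 'cV[C]_p,
    0 <= (\sum_(i < k) \sum_(j < k) (adj (v i) *m X i j *m v j) 0 0).

Definition cp_map (m n : nat) (Phi : 'M[C]_m -> 'M[C]_n) : Prop :=
  forall (k : nat) (X : 'I_k -> 'I_k -> 'M[C]_m),
    block_psd X -> block_psd (fun i j => Phi (X i j)).

Definition channel (m n : nat) (Phi : 'M[C]_m -> 'M[C]_n) : Prop :=
  [/\ (forall (a : C) (A B : 'M[C]_m), Phi (a *: A + B) = a *: Phi A + Phi B),
      cp_map Phi &
      (forall A : 'M[C]_m, \tr (Phi A) = \tr A)].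

Definition unitary (p : nat) (U : 'M[C]_p) : Prop := U *m adj U = 1%:M.

Definition spectrum (p : nat) (A : 'M[C]_p) (lam : 'I_p -> R) : Prop :=
  exists U : 'M[C]_p, unitary U /\
    A = U *m diag_mx (\row_i ((lam i)%:C)%C) *m adj U.

Definition hs_norm (p : nat) (A : 'M[C]_p) : R :=
  Num.sqrt (@complex.Re R (\tr (adj A *m A))).

(* ||Phi||_{1->2} for a channel: max over density matrices of ||Phi rho||_2 *)
Definition norm12 (m n : nat) (Phi : 'M[C]_m -> 'M[C]_n) : R :=
  sup [set t | exists rho : 'M[C]_m, density rho /\ t = hs_norm (Phi rho)].

Definition xlnx (x : R) : R := if x == 0 then 0 else x * ln x.

Definition renyi (alpha : R) (p : nat) (lam : 'I_p -> R) : R :=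
  if alpha == 1 then - \sum_(i < p) xlnx (lam i)
  else (1 - alpha)^-1 * ln (\sum_(i < p) powR (lam i) alpha).

Definition Smin (alpha : R) (m n : nat) (Phi : 'M[C]_m -> 'M[C]_n) : R :=
  inf [set s | exists (rho : 'M[C]_m) (lam : 'I_n -> R),
          [/\ density rho, spectrum (Phi rho) lam & s = renyi alpha lam]].

Definition kk (c : R) : R := (Num.truncn (c^-1))%:R.
Definition Delta (c : R) : R := Num.sqrt (c - (1 - c) / kk c).

Definition g_fun (alpha c : R) : R :=
  let k := kk c in let D := Delta c in
  if alpha == 1 then
    ln (k + 1) - (1 + k)^-1 * (xlnx (1 + D) * k + xlnx (1 - k * D))
  else
    (1 - alpha)^-1 *
      ln (k * powR ((1 + D) / (1 + k)) alpha + powR ((1 - k * D) / (1 + k)) alpha).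

End QInfo.

(* Main.v *)
Require Import Defs.
From HB Require Import structures.
From mathcomp Require Import all_boot all_order all_algebra.
From mathcomp Require Import all_classical all_reals.
From mathcomp Require Import exp.
From mathcomp Require Import complex.
From mathcomp Require Import normedtype sequences derive.
From mathcomp Require Import spectral ring lra.
Import Order.TTheory GRing.Theory Num.Theory.
Import numFieldNormedType.Exports.
Local Open Scope ring_scope.

(** Write phi for t^alpha (or t ln t when alpha = 1), so that the entropy is a
decreasing function of the sum of phi over the spectrum, and let c be the
squared norm of the channel, an upper bound for the purity of every output.
It suffices to show that a probability vector p with purity at most c satisfies
sum phi(p_i) <= k phi(a) + phi(b), where (a, ..., a, b) is the vector with k
entries a >= b, total mass 1 and purity exactly c.  Let u be the (k+1)-st largest
entry of p, and let q be the quadratic polynomial with q(0) = 0 whose derivative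
is the chord of phi' between u and a.  As phi' is concave, phi - q decreases on
[0, u], increases on [u, a] and decreases afterwards, so comparing the sorted
entries of p one by one with (a, ..., a, b, 0, ..., 0) bounds the sum of phi - q;
the sum of q is controlled by the mass and the purity, since phi' is
nondecreasing and q therefore has a nonnegative leading coefficient.

When n = 2 a spectrum is determined by its purity, so only continuity of the
entropy along outputs whose purity tends to c is needed. *)

(** * Concave derivatives and comparison with a quadratic *)

Section Analysis.
Context {R : realType}.
Implicit Types (phi psi gam : R -> R) (x y t u a b c d l mu : R) (s : seq R).

(** Concavity of the derivative [psi] is encoded by tangent lines, [gam y] being a supergradient at
    [y]. The conditions concern positive points, as the derivative of t ln t diverges at 0. *)
Definition concave_derive phi psi gam : Prop :=
  [/\ forall x, 0 < x -> is_derive x 1 phi (psi x),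
      forall x y, 0 < x -> 0 < y -> psi x <= psi y + gam y * (x - y)
    & forall x y, 0 < x -> x <= y -> psi x <= psi y].

Lemma derive_sign_le (f df : R -> R) x y :
  0 < x -> x <= y -> (forall t, 0 < t -> is_derive t 1 f (df t)) ->
  (forall t, x <= t <= y -> 0 <= df t) -> f x <= f y.
Proof.
move=> x0 xy dfE df0.
have [| |t txy E] := @MVT_segment R f df x y xy.
- by move=> t /itvP txy; apply: dfE; rewrite (lt_le_trans x0)// txy.
- apply: derivable_within_continuous => t /itvP txy.
  by apply: ex_derive; apply: dfE; rewrite (lt_le_trans x0)// txy.
by rewrite -subr_ge0 E mulr_ge0 ?subr_ge0// df0// !(itvP txy).
Qed.

(* [phi] need not be differentiable at 0; the bound [phi x <= x] near 0 is what
   extends the monotonicity of [H] down to 0. *)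
Lemma quadratic_comparison phi psi gam u a :
  concave_derive phi psi gam ->
  phi 0 = 0 -> (forall x, 0 < x <= 1 -> phi x <= x) -> 0 < u < a ->
  exists l mu, let H x := phi x - (l * x ^+ 2 + mu * x) in
  [/\ 0 <= l, forall x, 0 <= x <= u -> H x <= 0,
      forall x, 0 <= x <= a -> H u <= H x &
      forall x, u <= x -> H x <= H a].
Proof.
move=> [dphi cpsi mpsi] phi0 phi_le /andP[u0 ua].
have a0 : 0 < a := lt_trans u0 ua.
have au0 : 0 < a - u by rewrite subr_gt0.
pose d := (psi a - psi u) / (a - u).
have dE : d * (a - u) = psi a - psi u by rewrite mulfVK// gt_eqF.
have d0 : 0 <= d by rewrite divr_ge0 ?subr_ge0 ?mpsi ?ltW.
pose l := d / 2; pose mu := psi u - d * u.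
pose H x := phi x - (l * x ^+ 2 + mu * x).
(* [h] is [psi] minus its chord, that is, the derivative of [H]. It is concave and vanishes at [u]
   and [a], which determines its signs. *)
pose h x := psi x - (d * x + mu).
have dH x : 0 < x -> is_derive x 1 H (h x).
  move=> x0; have ? := dphi x x0.
  rewrite /H; apply: is_derive_eq.
  rewrite /h /l /GRing.scale/=; by field.
have hlow t : 0 < t -> t <= u -> h t <= 0.
  move=> t0 tu; have h1 := cpsi t u t0 u0; have h2 := cpsi a u a0 u0.
  have : d <= gam u.
    by rewrite -(ler_pM2r au0) dE; lra.
  move=> dg; have : (gam u - d) * (t - u) <= 0 by apply: mulr_ge0_le0; lra.
  by rewrite /h /mu; lra.
have hmid t : u <= t -> t <= a -> 0 <= h t.
  move=> ut ta; have t0 := lt_le_trans u0 ut.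
  (* The tangent at [t] is evaluated at [u] and [a]; with weights [a - t] and [t - u] the terms in
     [gam t] cancel. *)
  have h1 := cpsi u t u0 t0; have h2 := cpsi a t a0 t0.
  have e1 : (psi u) * (a - t) <= (psi t + gam t * (u - t)) * (a - t).
    by apply: ler_wpM2r; lra.
  have e2 : (psi a) * (t - u) <= (psi t + gam t * (a - t)) * (t - u).
    by apply: ler_wpM2r; lra.
  rewrite -(pmulr_lge0 _ au0).
  have -> : h t * (a - u) = psi t * (a - u) - psi u * (a - t) - psi a * (t - u).
    transitivity (psi t * (a - u) - d * (a - u) * (t - u) - psi u * (a - u)).
      by rewrite /h /mu; ring.
    by rewrite dE; ring.
  by move: e1 e2; lra.
have hhigh t : a <= t -> h t <= 0.
  move=> at_; have t0 := lt_le_trans a0 at_.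
  have h1 := cpsi u a u0 a0; have h2 := cpsi t a t0 a0.
  have : gam a <= d.
    by rewrite -(ler_pM2r au0) dE; lra.
  move=> dg; have : (gam a - d) * (t - a) <= 0 by apply: mulr_le0_ge0; lra.
  by rewrite /h /mu; lra.
have dNH : forall x, 0 < x -> is_derive x 1 (fun z => - H z) (- h x).
  by move=> x x0; have ? := dH x x0; apply: is_deriveN.
have Hlow x y : 0 < x -> x <= y -> y <= u -> H y <= H x.
  move=> x0 xy yu; rewrite -lerN2.
  apply: (derive_sign_le (fun z => - H z) (fun z => - h z)) => // t /andP[xt ty].
  by rewrite oppr_ge0 hlow//; lra.
have Hmid x y : u <= x -> x <= y -> y <= a -> H x <= H y.
  move=> ux xy ya.
  apply: (derive_sign_le H h) => //; first lra.
  by move=> t /andP[xt ty]; rewrite hmid//; lra.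
have Hhigh x y : a <= x -> x <= y -> H y <= H x.
  move=> ax xy; rewrite -lerN2.
  apply: (derive_sign_le (fun z => - H z) (fun z => - h z)) => //; first lra.
  by move=> t /andP[xt ty]; rewrite oppr_ge0 hhigh//; lra.
have l0 : 0 <= l by rewrite divr_ge0.
have H00 : H 0 = 0 by rewrite /H phi0 expr0n/= !mulr0 addr0 subr0.
have Hneg x : 0 <= x -> x <= u -> H x <= 0.
  rewrite le_eqVlt => /orP[/eqP<-|x0 xu]; first by rewrite H00.
  apply/ler_addgt0Pr => e e0; rewrite add0r.
  have m0 : 0 < 1 + `|mu| by rewrite ltr_wpDr.
  (* The three bounds on [t] give [H x <= H t], [phi t <= t] and [t + |mu| * t <= e]. *)
  pose t := Num.min x (Num.min 1 (e / (1 + `|mu|))).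
  have t0 : 0 < t by rewrite !lt_min x0 ltr01 divr_gt0.
  have tx : t <= x by rewrite ge_min lexx.
  have t1 : t <= 1 by rewrite !ge_min lexx orbT.
  have te : t <= e / (1 + `|mu|) by rewrite !ge_min lexx !orbT.
  apply: le_trans (Hlow t x t0 tx xu) _.
  have := phi_le t; rewrite t0 t1 => /(_ isT) pt.
  have : 0 <= l * t ^+ 2 by rewrite mulr_ge0// sqr_ge0.
  have : - mu * t <= `|mu| * t by rewrite ler_pM2r// -normrN ler_norm.
  move: te; rewrite ler_pdivlMr// /H; lra.
exists l, mu; split => //=.
- by move=> x /andP[? ?]; exact: Hneg.
- move=> x /andP[]; rewrite le_eqVlt => /orP[/eqP<- _|x0 xa].
    by rewrite -!/(H _) H00 Hneg// ltW.
  have [xu|/ltW ux] := leP x u; first exact: Hlow.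
  exact: Hmid.
- move=> x ux; have [xa|/ltW ax] := leP x a; first exact: Hmid.
  exact: Hhigh.
Qed.

End Analysis.

(** * Sums over sorted probability vectors *)

Section Sums.
Context {R : realType}.
Implicit Types (phi psi gam : R -> R) (x y t u a b c d l mu : R) (s : seq R).

(** The squared deviations from 1/k add up to at most 1/k - 2/k + 1/k = 0. *)
Lemma min_sum_sqr_uniform (k : nat) s :
  (size s <= k)%N -> (0 < k)%N -> \sum_(x <- s) x = 1 ->
  \sum_(x <- s) x ^+ 2 <= k%:R^-1 -> forall x, x \in s -> x = k%:R^-1.
Proof.
move=> sk k0 s1 s2 x xs; have kR : 0 < k%:R :> R by rewrite ltr0n.
have : \sum_(y <- s) (y - k%:R^-1) ^+ 2 <= 0.
  rewrite (eq_bigr (fun y => y ^+ 2 - (2 * k%:R^-1) * y + k%:R^-1 ^+ 2)); last first.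
    by move=> y _; ring.
  rewrite big_split big_split/= sumrN -mulr_sumr s1 mulr1 big_const_seq count_predT.
  rewrite iter_addr_0 -mulr_natr.
  have : k%:R^-1 ^+ 2 * (size s)%:R <= k%:R^-1 :> R.
    rewrite expr2 -mulrA ler_piMr ?invr_ge0 ?ler0n// ler_pdivrMl// mulr1.
    by rewrite ler_nat.
  lra.
rewrite le_eqVlt ltNge sumr_ge0 ?orbF//; last by move=> *; exact: sqr_ge0.
rewrite psumr_eq0; last by move=> *; exact: sqr_ge0.
by move=> /allP/(_ x xs)/=; rewrite sqrf_eq0 subr_eq0 => /eqP.
Qed.

Lemma sum_le_extremal phi psi gam (k : nat) a b s :
  concave_derive phi psi gam ->
  phi 0 = 0 -> (forall x, 0 < x <= 1 -> phi x <= x) ->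
  (0 < k)%N -> 0 <= b -> b < a -> k%:R * a + b = 1 ->
  all (fun x => 0 <= x) s -> \sum_(x <- s) x = 1 ->
  \sum_(x <- s) x ^+ 2 <= k%:R * a ^+ 2 + b ^+ 2 ->
  \sum_(x <- s) phi x <= k%:R * phi a + phi b.
Proof.
move=> cphi phi0 phi_le k0 b0 ba ab1 s0 s1 s2.
have kR : 1 <= k%:R :> R by rewrite ler1n.
(* Appending k + 1 zeros guarantees a (k+1)-st largest entry and changes no sum of a function
   vanishing at 0. *)
pose s' := sort (fun x y => y <= x) (s ++ nseq k.+1 0).
have sumE (f : R -> R) : f 0 = 0 -> \sum_(x <- s) f x = \sum_(x <- s') f x.
  have ps : perm_eq s' (s ++ nseq k.+1 0) by rewrite perm_sort.
  move=> f0; rewrite (perm_big _ ps) big_cat.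
  rewrite [X in _ = _ + X]big1_seq ?addr0// => x /andP[_].
  by rewrite mem_nseq => /andP[_ /eqP->].
have s'0 : all (fun x => 0 <= x) s'.
  by rewrite all_sort all_cat s0 all_nseq lexx orbT.
have : pairwise (fun x y => y <= x) s'.
  rewrite -sorted_pairwise; last by move=> x y z yx zx; exact: le_trans zx yx.
  by apply: sort_sorted => x y; exact: le_total.
have sz : (k < size s')%N by rewrite size_sort size_cat size_nseq addnS ltnS leq_addl.
move: s1 s2; rewrite (sumE (fun x => x))// (sumE (fun x => x ^+ 2)) ?expr0n//.
rewrite (sumE phi)//.
clear sumE s0; clearbody s'; move: sz s'0; move: s' {s} => s sz.
have szp : size (take k s) = k by rewrite size_take sz.
move: (cat_take_drop k s); rewrite (drop_nth 0 sz); move: szp.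
move: (take k s) (nth 0 s k) (drop k.+1 s) => p u q szp <-{s sz}.
rewrite all_cat !big_cat/= !big_cons/= => /and3P[p0 u0 q0] s1 s2.
rewrite pairwise_cat/= => /and3P[/allrelP pq _ /andP[/allP uq _]].
have pu x : x \in p -> u <= x by move=> xp; apply: pq; rewrite ?mem_head.
have sum_pu : k%:R * u <= \sum_(x <- p) x.
  rewrite -szp -sum1_size natr_sum mulr_suml !big_seq ler_sum// => x xp.
  by rewrite mul1r pu.
have q_ge0 : 0 <= \sum_(x <- q) x.
  by rewrite big_seq sumr_ge0// => x /(allP q0).
(* Otherwise the first k + 1 entries would sum to at least (k + 1) a > k a + b = 1. *)
have ua : u < a by rewrite -(ltr_pM2l (lt_le_trans ltr01 kR)); nra.
move: u0; rewrite le_eqVlt => /orP[/eqP u0|u0].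
  (* At most [k] entries are nonzero, and the purity bound then forces them all
     to equal [1 / k], which is the case [b = 0]. *)
  have q0' x : x \in q -> x = 0.
    by move=> xq; apply/eqP; rewrite eq_le (allP q0)// u0 uq.
  have qE (f : R -> R) : f 0 = 0 -> \sum_(x <- q) f x = 0.
    by move=> f0; rewrite big1_seq// => x /andP[_ /q0' ->].
  move: s1 s2; rewrite -u0 expr0n/= phi0 !qE ?expr0n//= !addr0 => s1 s2.
  have kE : k%:R * k%:R^-1 = 1 :> R by rewrite mulfV//; lra.
  have ki : 0 < k%:R^-1 :> R by rewrite invr_gt0; lra.
  have aE : a = (1 - b) * k%:R^-1.
    have -> : 1 - b = k%:R * a by lra.
    by rewrite mulrAC kE mul1r.
  (* The second factor is negative because b < a. So the purity is at most 1/k, and once it is known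
     to equal 1/k, b must vanish. *)
  have bE : k%:R * a ^+ 2 + b ^+ 2 - k%:R^-1 = b * (b - a - k%:R^-1).
    have -> : k%:R * a ^+ 2 = (1 - b) * a.
      by rewrite expr2 mulrA; congr (_ * _); lra.
    have : a = k%:R^-1 - b * k%:R^-1 by (rewrite {1}aE; ring).
    lra.
  have pE : forall x, x \in p -> x = k%:R^-1.
    apply: min_sum_sqr_uniform => //; first by rewrite szp.
    apply: le_trans s2 _; rewrite -subr_le0 bE; apply: mulr_ge0_le0 => //; lra.
  have p2 : \sum_(x <- p) x ^+ 2 = k%:R^-1.
    rewrite big_seq (eq_bigr (fun x => k%:R^-1 * x)); last first.
      by move=> x /pE ->; rewrite expr2.
    by rewrite -big_seq -mulr_sumr s1 mulr1.
  have b00 : b = 0.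
    apply/eqP; rewrite eq_le b0 andbT leNgt; apply/negP => b_gt0.
    move: s2; rewrite p2 -subr_ge0 bE pmulr_rge0//; lra.
  rewrite b00 phi0 addr0 aE b00 subr0 mul1r.
  rewrite big_seq (eq_bigr (fun x => phi k%:R^-1)) => [|x /pE -> //].
  by rewrite -big_seq big_const_seq count_predT iter_addr_0 szp mulr_natl.
(* The entries of [p] are compared with [a], the entry [u] with [b], and the entries of [q] with
   0. *)
have [l [mu [l0 Hq Hu Hp]]] :=
  quadratic_comparison _ _ _ u a cphi phi0 phi_le (introT andP (conj u0 ua)).
pose H x := phi x - (l * x ^+ 2 + mu * x).
rewrite -/(H u) in Hu; rewrite -/(H a) in Hp.
have phiE x : phi x = H x + (l * x ^+ 2 + mu * x) by rewrite /H subrK.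
have sumphi r : \sum_(x <- r) phi x =
    \sum_(x <- r) H x + (l * (\sum_(x <- r) x ^+ 2) + mu * \sum_(x <- r) x).
  by rewrite !mulr_sumr -!big_split/=; apply: eq_bigr => x _; exact: phiE.
have Hp' : \sum_(x <- p) H x <= k%:R * H a.
  rewrite -szp -sum1_size natr_sum mulr_suml !big_seq ler_sum// => x xp.
  by rewrite mul1r Hp// pu.
have Hq' : \sum_(x <- q) H x <= 0.
  rewrite big_seq; apply: sumr_le0 => x xq; apply: Hq.
  by rewrite (allP q0)//= uq.
have Hb : H u <= H b by apply: Hu; rewrite b0 ltW.
have : l * (\sum_(x <- p) x ^+ 2 + (u ^+ 2 + \sum_(x <- q) x ^+ 2)) <=
       l * (k%:R * a ^+ 2 + b ^+ 2) by apply: ler_wpM2l.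
have : mu * (\sum_(x <- p) x + (u + \sum_(x <- q) x)) = mu * (k%:R * a + b).
  by rewrite s1 ab1.
rewrite !sumphi !phiE; lra.
Qed.

End Sums.

(** * Entropies and the extremal spectrum *)

Section Entropies.
Context {R : realType}.
Implicit Types (alpha x y t u a b c d r S : R).

Definition entropic alpha : R -> R :=
  if alpha == 1 then @xlnx R else fun x => powR x alpha.

Definition entropic_derive alpha : R -> R :=
  if alpha == 1 then fun x => ln x + 1 else fun x => alpha * powR x (alpha - 1).

Lemma xlnxE x : xlnx x = x * ln x.
Proof. by rewrite /xlnx; case: eqP => // ->; rewrite mul0r. Qed.

Lemma ln_tangent x y : 0 < x -> 0 < y -> ln x <= ln y + y^-1 * (x - y).
Proof.
move=> x0 y0; rewrite -lerBlDl -ln_div ?posrE//.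
have -> : x / y = 1 + y^-1 * (x - y) by field; rewrite gt_eqF.
apply: le_ln1Dx; rewrite mulrBr mulVf ?gt_eqF//.
have : 0 < y^-1 * x by rewrite mulr_gt0 ?invr_gt0.
lra.
Qed.

(** Young's inequality with exponents 1/b and 1/(1 - b), applied to (x/y)^b and 1, gives (x/y)^b <=
    b x/y + 1 - b; multiply by y^b. *)
Lemma powR_tangent x y b : 0 < b < 1 -> 0 < x -> 0 < y ->
  powR x b <= powR y b + b * powR y (b - 1) * (x - y).
Proof.
move=> /andP[b0 b1] x0 y0.
have b1' : 0 < 1 - b by lra.
have xy0 : 0 < x / y by rewrite divr_gt0.
have := @conjugate_powR R (powR (x / y) b) 1 b^-1 (1 - b)^-1.
rewrite powR_ge0 ler01 !invr_gt0 b0 b1' !invrK subrKC => /(_ isT isT isT isT erefl).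
rewrite (_ : powR 1 (1 - b)^-1 = 1); last by rewrite powR1.
rewrite -powRrM mulfV ?gt_eqF// powRr1 ?(ltW xy0)// mulr1 mul1r.
rewrite -(ler_pM2r (powR_gt0 b y0)) -powRM ?(ltW xy0) ?(ltW y0)// divfK ?gt_eqF//.
have -> : powR y (b - 1) = powR y b / y.
  by rewrite powRB ?powRr1 ?(ltW y0)// (gt_eqF y0) implybT.
move=> /le_trans; apply; rewrite le_eqVlt; apply/orP; left; apply/eqP; field.
by rewrite gt_eqF.
Qed.

(** For [alpha] above 1, [alpha < 2] puts the exponent alpha - 1 of the derivative in (0, 1), hence
    concavity. The supergradient is the second derivative of [entropic alpha]. *)
Lemma entropic_concave_derive alpha : 1 <= alpha < 2 ->
  exists gam, concave_derive (entropic alpha) (entropic_derive alpha) gam.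
Proof.
move=> /andP[a1 a2]; rewrite /entropic /entropic_derive; case: eqP => [_|/eqP an1].
  exists GRing.inv; split.
  - move=> x x0; have -> : @xlnx R = (fun y => y * ln y).
      by apply/funext => y; rewrite xlnxE.
    have dln := is_derive1_ln x0.
    apply: is_derive_eq; rewrite /GRing.scale/=.
    by rewrite mulfV ?gt_eqF// mulr1 addrC.
  - by move=> x y x0 y0; have := ln_tangent _ _ x0 y0; lra.
  - by move=> x y x0 xy; rewrite lerD2r ler_ln ?posrE ?(lt_le_trans x0).
have {}a1 : 1 < alpha by rewrite lt_neqAle eq_sym an1.
exists (fun y => alpha * ((alpha - 1) * powR y (alpha - 1 - 1))); split.
- by move=> x x0; exact: is_derive1_powR.
- move=> x y x0 y0; rewrite -mulrA -mulrDr ler_pM2l; last lra.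
  by apply: powR_tangent => //; lra.
- move=> x y x0 xy; rewrite ler_pM2l; last lra.
  by apply: ge0_ler_powR; rewrite ?nnegrE; lra.
Qed.

Lemma entropic0 alpha : 1 <= alpha -> entropic alpha 0 = 0.
Proof.
move=> a1; rewrite /entropic; case: eqP => _; first by rewrite xlnxE mul0r.
by rewrite powR0//; lra.
Qed.

Lemma entropic_le alpha x : 1 <= alpha -> 0 < x <= 1 -> entropic alpha x <= x.
Proof.
move=> a1 /andP[x0 x1]; rewrite /entropic; case: eqP => _.
  by rewrite xlnxE ler_piMr ?(ltW x0)// (le_trans (ln_le0 x1)).
by rewrite ge1r_powR ?x0.
Qed.

Definition entropy_of alpha y := if alpha == 1 then - y else (1 - alpha)^-1 * ln y.

(** Inverting the decreasing [entropy_of] turns a lower bound on an entropy into a constant upper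
    bound on a sum, where limits are easier to take. *)
Lemma le_entropy_of alpha S y : 1 <= alpha -> (alpha != 1 -> 0 < y) ->
  (S <= entropy_of alpha y) =
  (y <= if alpha == 1 then - S else expR ((1 - alpha) * S)).
Proof.
rewrite /entropy_of; case: eqP => [_ _ _|/eqP an1 a1 y0].
  by rewrite lerNr.
have {}a1 : 1 < alpha by rewrite lt_neqAle eq_sym an1.
rewrite ler_ndivlMl; last lra.
by rewrite -[in RHS](lnK (_ : y \is Num.pos)) ?posrE ?y0// ler_expR.
Qed.

Lemma entropy_of_le alpha y z : 1 <= alpha -> (alpha != 1 -> 0 < y) -> y <= z ->
  entropy_of alpha z <= entropy_of alpha y.
Proof.
move=> a1 y0 yz; rewrite le_entropy_of//; apply: (le_trans yz).
rewrite -le_entropy_of// => /y0 y_gt0; exact: lt_le_trans yz.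
Qed.

Lemma renyiE alpha n (lam : 'I_n -> R) :
  renyi alpha lam = entropy_of alpha (\sum_i entropic alpha (lam i)).
Proof. by rewrite /renyi /entropy_of /entropic; case: eqP. Qed.

(* The extremal spectrum of purity [c] has [k] entries [major c] and one entry
   [minor c]. *)
Definition major c := (1 + Delta c) / (1 + kk c).
Definition minor c := (1 - kk c * Delta c) / (1 + kk c).

Lemma kk_itv c : 0 < c -> c <= 1 ->
  [/\ (0 < Num.truncn c^-1)%N, kk c * c <= 1 & 1 < (kk c + 1) * c].
Proof.
move=> c0 c1; have ci0 : 0 <= c^-1 by rewrite invr_ge0 ltW.
have /andP[h1 h2] := truncn_itv ci0.
split.
- by rewrite truncn_gt0 invf_ge1.
- by rewrite -ler_pdivlMr// div1r.
- by rewrite -ltr_pdivrMr// div1r natr1.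
Qed.

Lemma Delta_gt0 c : 0 < c -> c <= 1 -> 0 < Delta c.
Proof.
move=> c0 c1; have [k0 _ k1] := kk_itv _ c0 c1.
have {}k0 : 0 < kk c by rewrite ltr0n.
rewrite sqrtr_gt0 subr_gt0 ltr_pdivrMr//; lra.
Qed.

(** Everything follows from k Delta^2 = (k + 1) c - 1. In particular (k Delta)^2 = k (k + 1) c - k
    <= 1 because k c <= 1, so [minor c] is nonnegative. *)
Lemma major_minor c : 0 < c -> c <= 1 ->
  [/\ 0 <= minor c, minor c < major c, kk c * major c + minor c = 1 &
      kk c * major c ^+ 2 + minor c ^+ 2 = c].
Proof.
move=> c0 c1; have [k0 k1 k2] := kk_itv _ c0 c1; have D0 := Delta_gt0 _ c0 c1.
have {}k0 : 0 < kk c by rewrite ltr0n.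
have D2 : Delta c ^+ 2 = c - (1 - c) / kk c.
  by rewrite sqr_sqrtr// subr_ge0 ler_pdivrMr//; lra.
have kD2 : kk c * Delta c ^+ 2 = kk c * c - (1 - c).
  by rewrite D2; field; rewrite gt_eqF.
have kD : kk c * Delta c <= 1.
  rewrite -(@ler_pXn2r _ 2)// ?nnegrE ?mulr_ge0 ?(ltW k0) ?(ltW D0)//.
  rewrite exprMn expr1n expr2 -mulrA kD2; nra.
have kn : 1 + kk c != 0 by rewrite gt_eqF//; lra.
split.
- by rewrite divr_ge0//; lra.
- rewrite ltr_pM2r ?invr_gt0; last lra.
  have : 0 < kk c * Delta c by rewrite mulr_gt0.
  lra.
- by rewrite /major /minor; field.
- have -> : kk c * major c ^+ 2 + minor c ^+ 2 =
      (1 + kk c * Delta c ^+ 2) / (1 + kk c) by rewrite /major /minor; field.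
  by rewrite kD2; field.
Qed.

Lemma g_funE alpha c : 0 < c -> c <= 1 ->
  g_fun alpha c =
  entropy_of alpha (kk c * entropic alpha (major c) + entropic alpha (minor c)).
Proof.
move=> c0 c1; rewrite /g_fun /entropy_of /entropic; case: eqP => //= _.
have [k0 _ _] := kk_itv _ c0 c1; have {}k0 : 0 < kk c by rewrite ltr0n.
have D0 := Delta_gt0 _ c0 c1.
have [b0 _ _ _] := major_minor _ c0 c1.
have kp : 0 < 1 + kk c by lra.
(* [minor c] vanishes when c = 1/k, so the logarithm of the quotient is split only under the factor
   [minor c]. *)
have lnb : minor c * ln (minor c) =
    minor c * (ln (1 - kk c * Delta c) - ln (1 + kk c)).
  move: b0; rewrite le_eqVlt => /orP[/eqP <-|]; first by rewrite !mul0r.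
  by rewrite pmulr_lgt0 ?invr_gt0// => b0; rewrite ln_div ?posrE.
rewrite !xlnxE lnb (ln_div (_ : 1 + Delta c \is Num.pos)) ?posrE//; last lra.
rewrite /major /minor (addrC _ 1); field.
by rewrite gt_eqF.
Qed.

Lemma entropic_sum_gt0 alpha n (lam : 'I_n -> R) : alpha != 1 ->
  (forall i, 0 <= lam i) -> \sum_i lam i = 1 -> 0 < \sum_i entropic alpha (lam i).
Proof.
move=> an1 lam0 lam1; rewrite /entropic (negbTE an1) lt_def sumr_ge0 ?andbT; last first.
  by move=> i _; exact: powR_ge0.
apply/negP; rewrite psumr_eq0; last by move=> i _; exact: powR_ge0.
move=> /allP lam00; have /eqP := lam1; rewrite big1 1?eq_sym ?oner_eq0// => i _.
by have /eqP/powR_eq0_eq0 := lam00 i (mem_index_enum _).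
Qed.

Lemma g_fun_le_renyi alpha c n (lam : 'I_n -> R) : 1 <= alpha < 2 ->
  (forall i, 0 <= lam i) -> \sum_i lam i = 1 -> \sum_i lam i ^+ 2 <= c ->
  0 < c -> c <= 1 -> g_fun alpha c <= renyi alpha lam.
Proof.
move=> a12 lam0 lam1 lam2 c0 c1; have /andP[a1 a2] := a12.
rewrite renyiE g_funE//; apply: entropy_of_le => //.
  by move=> an1; exact: entropic_sum_gt0.
have [gam cphi] := entropic_concave_derive _ a12.
have [k0 _ _] := kk_itv _ c0 c1.
have [b0 ba ab1 ab2] := major_minor _ c0 c1.
pose s := [seq lam i | i <- index_enum 'I_n].
have sE (f : R -> R) : \sum_i f (lam i) = \sum_(x <- s) f x by rewrite big_map.
rewrite sE; apply: (sum_le_extremal _ _ _ _ _ _ _ cphi) => //.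
- exact: entropic0.
- by move=> x; exact: entropic_le.
- by rewrite all_map; apply/allP => i _ /=.
- by rewrite -(sE id).
- by rewrite -(sE (fun x => x ^+ 2)) ab2.
Qed.

End Entropies.

(** * Two-point spectra and continuity of their entropy *)

Section Binary.
Context {R : realType}.
Implicit Types (alpha x X y t u a b c d r S : R).

(** Here x is the gap between the two eigenvalues; the purity is (1 + x^2)/2. *)
Definition binary_entropic alpha x : R :=
  entropic alpha ((1 + x) / 2) + entropic alpha ((1 - x) / 2).

Lemma binary_entropicN alpha x : binary_entropic alpha (- x) = binary_entropic alpha x.
Proof. by rewrite /binary_entropic opprK addrC. Qed.

(** For c > 1/2 one has k = 1. At c = 1/2 one has k = 2, and the extremal spectrum (1/2, 1/2, 0) has
    an extra zero that contributes nothing. *)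
Lemma binary_major_minor alpha c : 1 <= alpha -> 2^-1 <= c -> c <= 1 ->
  kk c * entropic alpha (major c) + entropic alpha (minor c) =
  binary_entropic alpha (Num.sqrt (2 * c - 1)).
Proof.
move=> a1 c2 c1; have c0 : 0 < c by lra.
have ci : 0 <= c^-1 by rewrite invr_ge0 ltW.
move: c2; rewrite le_eqVlt => /orP[/eqP ch|ch].
  have k2 : kk c = 2.
    rewrite /kk -ch invrK; congr (_%:R); apply: truncn_def.
    by rewrite lexx ltr_nat.
  have D2 : Delta c = 2^-1.
    rewrite /Delta k2 -ch (_ : _ - _ = 2^-1 ^+ 2); last by field.
    by rewrite sqrtr_sqr ger0_norm ?invr_ge0 ?ler0n.
  have h2 : 2 * 2^-1 = 1 :> R by field.
  rewrite /binary_entropic /major /minor k2 D2 -ch h2 subrr sqrtr0.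
  rewrite mul0r entropic0// !addr0 subr0 mulr_natl mulr2n.
  by congr (entropic _ _ + entropic _ _); field.
have k1 : kk c = 1.
  rewrite /kk (@truncn_def _ _ 1)//; apply/andP; split.
    by rewrite invf_ge1.
  by rewrite -[X in _ < X]invrK ltf_pV2 ?posrE ?invr_gt0.
have D : Delta c = Num.sqrt (2 * c - 1).
  by rewrite /Delta k1; congr Num.sqrt; field.
by rewrite /binary_entropic /major /minor k1 D !mul1r.
Qed.

Lemma sum_entropic_binary alpha (lam : 'I_2 -> R) : \sum_i lam i = 1 ->
  \sum_i entropic alpha (lam i) =
  binary_entropic alpha (Num.sqrt (2 * (\sum_i lam i ^+ 2) - 1)).
Proof.
rewrite !big_ord_recl !big_ord0 !addr0; set p := lam _; set q := lam _ => pq.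
have -> : 2 * (p ^+ 2 + q ^+ 2) - 1 = (p - q) ^+ 2.
  have -> : q = 1 - p by lra.
  ring.
rewrite sqrtr_sqr.
have -> : binary_entropic alpha `|p - q| = binary_entropic alpha (p - q).
  by case: (ger0P (p - q)) => // _; rewrite binary_entropicN.
by rewrite /binary_entropic; congr (entropic _ _ + entropic _ _); lra.
Qed.

(** The derivative, ln t + 1 or alpha t^(alpha - 1), is at most 2 on (0, 1]. *)
Lemma entropic_upper_modulus alpha x y : 1 <= alpha < 2 -> 0 < x -> x <= y -> y <= 1 ->
  entropic alpha y - entropic alpha x <= 2 * (y - x).
Proof.
move=> a12 x0 xy y1; have [gam [dphi _ _]] := entropic_concave_derive _ a12.
suff : 2 * x - entropic alpha x <= 2 * y - entropic alpha y by lra.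
apply: (@derive_sign_le _ (fun t => 2 * t - entropic alpha t)
                        (fun t => 2 - entropic_derive alpha t)) => // t.
  move=> t0; have ? := dphi t t0; apply: is_derive_eq.
  by rewrite /GRing.scale/=; ring.
move=> /andP[xt ty]; rewrite subr_ge0 /entropic_derive.
have /andP[a1 a2] := a12.
case: eqP => _; first by have : ln t <= 0 by [apply: ln_le0; lra]; lra.
have : powR t (alpha - 1) <= powR 1 (alpha - 1).
  by apply: ge0_ler_powR; rewrite ?nnegrE; lra.
rewrite powR1; have := powR_ge0 t (alpha - 1); nra.
Qed.

(** For alpha = 1 the slope is unbounded near 0, hence the increment r^2: the left side is at most
    -r^2 ln(r^2) = 2 r^2 ln(1/r) <= 2 r. For alpha > 1 it is nonpositive. *)
Lemma entropic_lower_modulus alpha x r : 1 <= alpha -> 0 <= x -> 0 < r ->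
  x + r ^+ 2 <= 1 ->
  entropic alpha x - entropic alpha (x + r ^+ 2) <= 2 * r.
Proof.
move=> a1 x0 r0 xr1; have r2 : 0 < r ^+ 2 by rewrite exprn_gt0.
rewrite /entropic; case: eqP => _; last first.
  have : powR x alpha <= powR (x + r ^+ 2) alpha.
    by apply: ge0_ler_powR; rewrite ?nnegrE; lra.
  lra.
rewrite !xlnxE.
have h1 : x * ln x <= x * ln (x + r ^+ 2).
  move: x0; rewrite le_eqVlt => /orP[/eqP<-|x0]; first by rewrite !mul0r.
  by rewrite ler_pM2l// ler_ln ?posrE//; lra.
have h2 : r ^+ 2 * ln (r ^+ 2) <= r ^+ 2 * ln (x + r ^+ 2).
  by rewrite ler_pM2l// ler_ln ?posrE//; lra.
have h3 : - (r ^+ 2 * ln (r ^+ 2)) <= 2 * r.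
  rewrite lnXn// mulr2n.
  have : ln r^-1 * r ^+ 2 <= r^-1 * r ^+ 2.
    by rewrite ler_pM2r// ltW// ln_sublinear ?invr_gt0.
  rewrite [X in _ <= X](_ : _ = r); last by field; rewrite gt_eqF.
  by rewrite lnV ?posrE//; lra.
lra.
Qed.

Lemma binary_entropic_le_lim alpha X M : 1 <= alpha < 2 -> 0 <= X <= 1 ->
  (forall e, 0 < e -> exists x,
     [/\ 0 <= x, x <= X, X ^+ 2 - x ^+ 2 <= e & binary_entropic alpha x <= M]) ->
  binary_entropic alpha X <= M.
Proof.
move=> a12 /andP[X0 X1] approx; have /andP[a1 _] := a12.
apply/ler_addgt0Pr => e e0.
(* The total error will be 2 d^2 + 2 d <= 4 d <= 4 r <= e, where d^2 = (X - x)/2. *)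
pose r := Num.min 1 (e / 4).
have r0 : 0 < r by rewrite lt_min ltr01 divr_gt0.
have r1 : r <= 1 by rewrite ge_min lexx.
have re : r <= e / 4 by rewrite ge_min lexx orbT.
(* Since (X - x)^2 <= X^2 - x^2, this tolerance gives X - x <= 2 r^2. *)
have [|x [x0 xX xe xM]] := approx ((2 * r ^+ 2) ^+ 2).
  by rewrite exprn_gt0// mulr_gt0// exprn_gt0.
have [->|xnX] := eqVneq X x; first lra.
have {}xX : x < X by rewrite lt_neqAle eq_sym xnX.
pose d := Num.sqrt ((X - x) / 2).
have d0 : 0 < d by rewrite sqrtr_gt0; lra.
have d2 : d ^+ 2 = (X - x) / 2 by rewrite sqr_sqrtr//; lra.
have dr : d <= r.
  rewrite -(@ler_pXn2r _ 2)// ?nnegrE ?(ltW d0) ?(ltW r0)// d2.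
  have r20 : 0 < r ^+ 2 by rewrite exprn_gt0.
  have : X - x <= 2 * r ^+ 2.
    rewrite -(@ler_pXn2r _ 2)// ?nnegrE; [|lra|lra].
    by apply: le_trans xe; nra.
  lra.
have hu : entropic alpha ((1 + X) / 2) - entropic alpha ((1 + x) / 2) <=
    2 * ((1 + X) / 2 - (1 + x) / 2).
  by apply: entropic_upper_modulus => //; lra.
have hl : entropic alpha ((1 - X) / 2) -
    entropic alpha ((1 - X) / 2 + d ^+ 2) <= 2 * d.
  by apply: entropic_lower_modulus => //; rewrite ?d2; lra.
have xE : (1 - X) / 2 + d ^+ 2 = (1 - x) / 2 by rewrite d2; lra.
have dd : d ^+ 2 <= d by rewrite expr2 ler_piMr ?(ltW d0)//; lra.
move: xM hl hu; rewrite /binary_entropic xE; lra.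
Qed.

End Binary.

(** * Spectra of positive matrices and channel outputs *)

Section Channels.
Context {R : realType}.
Local Notation C := (complex R).

Lemma adjE p q (A : 'M[C]_(p, q)) : adj A = (A^T ^ Num.conj)%sesqui.
Proof. by rewrite /adj map_trmx. Qed.

Lemma adjM p q r (A : 'M[C]_(p, q)) (B : 'M[C]_(q, r)) :
  adj (A *m B) = adj B *m adj A.
Proof. by rewrite /adj map_mxM trmx_mul. Qed.

Lemma adjK p q (A : 'M[C]_(p, q)) : adj (adj A) = A.
Proof. by apply/matrixP => i j; rewrite !mxE conjcK. Qed.

Lemma adj_delta p q (i : 'I_p) (j : 'I_q) :
  adj (delta_mx i j : 'M[C]_(p, q)) = delta_mx j i.
Proof. by apply/matrixP => k l; rewrite !mxE andbC rmorph_nat. Qed.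

Lemma unitary_adjl p (U : 'M[C]_p) : unitary U -> adj U *m U = 1%:M.
Proof. exact: mulmx1C. Qed.

Lemma adj_real_diag p (lam : 'I_p -> R) :
  adj (diag_mx (\row_i ((lam i)%:C)%C)) = diag_mx (\row_i ((lam i)%:C)%C).
Proof.
apply/matrixP => i j; rewrite !mxE eq_sym; case: eqP => [->|_].
  by rewrite !mulr1n conjc_real.
by rewrite !mulr0n conjc0.
Qed.

Lemma psd_spectrum p (A : 'M[C]_p) : psd A -> exists lam, spectrum A lam.
Proof.
move=> [Aadj _].
have Aherm : A \is hermsymmx.
  by rewrite qualifE/= expr0 scale1r -adjE Aadj.
pose P := spectralmx A; pose sp := spectral_diag A.
have Pu : P \is unitarymx := spectral_unitarymx A.
exists (fun i => @complex.Re R (sp 0 i)), (invmx P).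
have adjP : adj P = invmx P by rewrite invmx_unitary// adjE.
rewrite -adjP /unitary adjK; split.
  by rewrite adjP mulVmx ?spectral_unit.
have /orthomx_spectralP {1}-> := hermitian_normalmx Aherm.
rewrite -/P -/sp adjP; congr (_ *m diag_mx _ *m _).
apply/rowP => i; rewrite mxE RRe_real//.
by have /mxOverP := hermitian_spectral_diag_real Aherm; apply.
Qed.

(** The eigenvalue [lam i] is the quadratic form of [A] at the i-th column of [U]. *)
Lemma spectrum_ge0 p (A : 'M[C]_p) lam i : psd A -> spectrum A lam -> 0 <= lam i.
Proof.
move=> [_ Apos] [U [Uu AE]].
have := Apos (U *m delta_mx i 0).
rewrite adjM {}AE !mulmxA -(mulmxA (adj _)) unitary_adjl// mulmx1.
rewrite -!mulmxA (mulmxA (adj U)) unitary_adjl// mul1mx.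
by rewrite adj_delta -rowE -colE !mxE eqxx mulr1n ler0c.
Qed.

Lemma spectrum_tr p (A : 'M[C]_p) lam : spectrum A lam ->
  \tr A = ((\sum_i lam i)%:C)%C.
Proof.
move=> [U [Uu ->]]; rewrite mxtrace_mulC mulmxA unitary_adjl// mul1mx mxtrace_diag.
by rewrite raddf_sum; apply: eq_bigr => i _; rewrite mxE.
Qed.

Lemma spectrum_hs_norm p (A : 'M[C]_p) lam : spectrum A lam ->
  hs_norm A ^+ 2 = \sum_i lam i ^+ 2.
Proof.
move=> [U [Uu AE]].
have A2 : spectrum (adj A *m A) (fun i => lam i ^+ 2).
  exists U; split=> //; rewrite AE !adjM adjK adj_real_diag !mulmxA.
  rewrite -(mulmxA (U *m _)) unitary_adjl// mulmx1 -(mulmxA U) mulmx_diag.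
  congr (_ *m diag_mx _ *m _); apply/rowP => i; rewrite !mxE.
  by rewrite expr2 rmorphM.
rewrite /hs_norm (spectrum_tr _ _ _ A2)/= sqr_sqrtr//.
by apply: sumr_ge0 => i _; exact: sqr_ge0.
Qed.

Lemma channel_density m n (Phi : 'M[C]_m -> 'M[C]_n) rho :
  channel Phi -> density rho -> density (Phi rho).
Proof.
move=> [_ cp trP] [[rhoadj rhopos] tr1]; split; last by rewrite trP.
(* Plain positivity is complete positivity for 1 x 1 blocks. *)
have [|Padj Ppos] := cp 1%N (fun _ _ => rho).
  split=> [//|v]; rewrite !big_ord1; exact: rhopos.
split; first by rewrite -(Padj ord0 ord0).
by move=> v; have := Ppos (fun _ => v); rewrite !big_ord1.
Qed.

(** A rank-one projector; it makes the sets behind [norm12] and [Smin] nonempty. *)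
Lemma density_exists m : (0 < m)%N -> exists rho : 'M[C]_m, density rho.
Proof.
case: m => // m _; pose e : 'cV[C]_m.+1 := delta_mx 0 0.
exists (e *m adj e); split; [split|].
- by rewrite adjM adjK.
- move=> v; rewrite mulmxA -mulmxA -[adj v *m e]adjK adjM adjK.
  by rewrite mxE big_ord1 !mxE mulrC -sqr_normc exprn_ge0.
- by rewrite mxtrace_mulC adj_delta mul_delta_mx /mxtrace big_ord1 mxE eqxx.
Qed.

End Channels.

(** * The norm of a channel *)

Section Norm.
Context {R : realType}.
Local Notation C := (complex R).

Lemma density_spectrum p (A : 'M[C]_p) lam : density A -> spectrum A lam ->
  [/\ forall i, 0 <= lam i, \sum_i lam i = 1 & hs_norm A ^+ 2 = \sum_i lam i ^+ 2].
Proof.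
move=> [Apos trA] Alam; split.
- by move=> i; exact: spectrum_ge0 Alam.
- by have := spectrum_tr _ _ _ Alam; rewrite trA => /(congr1 (@complex.Re R)) /= ->.
- exact: spectrum_hs_norm.
Qed.

(** The eigenvalues lie in [0, 1] and sum to 1, so the sum of their squares is positive and at most
    1. *)
Lemma density_hs_norm p (A : 'M[C]_p) : density A -> 0 < hs_norm A <= 1.
Proof.
move=> dA; have [lam Alam] := psd_spectrum _ _ (proj1 dA).
have [lam0 lam1 hsE] := density_spectrum _ _ _ dA Alam.
have hs0 : 0 <= hs_norm A by exact: sqrtr_ge0.
apply/andP; split.
  rewrite lt_neqAle hs0 andbT eq_sym -sqrf_eq0 hsE.
  rewrite psumr_eq0; last by move=> i _; exact: sqr_ge0.
  apply/negP => /allP lam00; have /eqP := lam1.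
  rewrite big1 1?eq_sym ?oner_eq0// => i _.
  by have := lam00 i (mem_index_enum _); rewrite /= sqrf_eq0 => /eqP.
rewrite -(@ler_pXn2r _ 2)// ?nnegrE ?ler01// expr1n hsE -lam1.
apply: ler_sum => i _; rewrite expr2 ler_piMr// -lam1 (bigD1 i)//= lerDl.
exact: sumr_ge0.
Qed.

Lemma norm12_ub m n (Phi : 'M[C]_m -> 'M[C]_n) rho :
  channel Phi -> density rho -> hs_norm (Phi rho) <= norm12 Phi.
Proof.
move=> chan drho; apply: sup_upper_bound; last by exists rho.
split; first by exists (hs_norm (Phi rho)), rho.
exists 1 => _ [sigma [dsigma ->]].
by have /andP[] := density_hs_norm _ _ (channel_density _ _ _ _ chan dsigma).
Qed.

(** Nearly optimal states take the place of a maximiser. *)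
Lemma norm12_adherent m n (Phi : 'M[C]_m -> 'M[C]_n) (e : R) : (0 < m)%N ->
  channel Phi -> 0 < e ->
  exists2 rho, density rho & norm12 Phi - e < hs_norm (Phi rho).
Proof.
move=> m0 chan e0; have [rho drho] := @density_exists R _ m0.
set A := [set t | exists rho : 'M[C]_m, density rho /\ t = hs_norm (Phi rho)]%classic.
have [|_ [sigma [dsigma ->]] h] := @sup_adherent R A e e0.
  split; first by exists (hs_norm (Phi rho)); exists rho.
  exists 1 => _ [sigma [dsigma ->]].
  by have /andP[] := density_hs_norm _ _ (channel_density _ _ _ _ chan dsigma).
by exists sigma.
Qed.

Lemma norm12_itv m n (Phi : 'M[C]_m -> 'M[C]_n) : (0 < m)%N ->
  channel Phi -> 0 < norm12 Phi <= 1.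
Proof.
move=> m0 chan; have [rho drho] := @density_exists R _ m0.
have /andP[hs0 _] := density_hs_norm _ _ (channel_density _ _ _ _ chan drho).
rewrite (lt_le_trans hs0 (norm12_ub _ _ _ _ chan drho))/=.
apply/ler_addgt0Pr => e e0.
have [sigma dsigma] := norm12_adherent _ _ _ _ m0 chan e0.
have /andP[_] := density_hs_norm _ _ (channel_density _ _ _ _ chan dsigma).
lra.
Qed.

End Norm.

(** * The entropy bound and equality for two-dimensional outputs *)

Theorem theorem6 (R : realType) (m n : nat) (Phi : 'M[complex R]_m -> 'M[complex R]_n)
    (alpha : R) :
  (0 < m)%N -> (0 < n)%N -> channel Phi -> 1 <= alpha < 2 ->
  g_fun alpha (norm12 Phi ^+ 2) <= Smin alpha Phi /\
  (n = 2%N -> Smin alpha Phi = g_fun alpha (norm12 Phi ^+ 2)).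
Proof.
move=> m0 _ chan a12; have /andP[a1 _] := a12.
have /andP[N0 N1] := norm12_itv _ _ _ m0 chan.
set c := norm12 Phi ^+ 2.
have c0 : 0 < c by rewrite exprn_gt0.
have c1 : c <= 1 by rewrite exprn_ile1// ltW.
have purity rho lam : density rho -> spectrum (Phi rho) lam ->
    [/\ forall i, 0 <= lam i, \sum_i lam i = 1, \sum_i lam i ^+ 2 <= c &
        hs_norm (Phi rho) ^+ 2 = \sum_i lam i ^+ 2].
  move=> drho slam.
  have [lam0 lam1 hsE] := density_spectrum _ _ _
    (channel_density _ _ _ _ chan drho) slam.
  split=> //; rewrite -hsE /c ler_pXn2r ?nnegrE ?sqrtr_ge0 ?(ltW N0)//.
  exact: norm12_ub.
pose E := [set s : R | exists rho lam,
  [/\ density rho, spectrum (Phi rho) lam & s = renyi alpha lam]]%classic.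
(* This gives the inequality and also the boundedness below that makes [Smin] at most each of its
   members. *)
have lbE : lbound E (g_fun alpha c).
  move=> _ [rho [lam [drho slam ->]]].
  by have [lam0 lam1 lam2 _] := purity _ _ drho slam; exact: g_fun_le_renyi.
have spec rho : density rho -> exists lam, spectrum (Phi rho) lam.
  by move=> drho; apply: psd_spectrum; case: (channel_density _ _ _ _ chan drho).
have le1 : g_fun alpha c <= Smin alpha Phi.
  apply: lb_le_inf => //.
  have [rho drho] := @density_exists R _ m0; have [lam slam] := spec _ drho.
  by exists (renyi alpha lam), rho, lam.
split=> // n2; subst n; apply/eqP; rewrite eq_le le1 andbT.
have Smin_le rho lam : density rho -> spectrum (Phi rho) lam ->
    Smin alpha Phi <= renyi alpha lam.
  move=> drho slam; apply: ge_inf; first by exists (g_fun alpha c).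
  by exists rho, lam.
have half_le (lam : 'I_2 -> R) : \sum_i lam i = 1 -> 2^-1 <= \sum_i lam i ^+ 2.
  rewrite !big_ord_recl !big_ord0 !addr0 => pq; set p := lam _ in pq *.
  set q := lam _ in pq *; have := sqr_ge0 (p - q).
  have -> : q = 1 - p by lra.
  lra.
(* [Num.sqrt] is 0 on negative numbers, so 2 c - 1 must be nonnegative for X^2 = 2 c - 1 to hold. *)
have c2 : 2^-1 <= c.
  have [rho drho] := @density_exists R _ m0; have [lam slam] := spec _ drho.
  by have [_ lam1 lam2 _] := purity _ _ drho slam; apply: le_trans lam2; exact: half_le.
rewrite g_funE// binary_major_minor//.
set X := Num.sqrt (2 * c - 1).
have X2 : X ^+ 2 = 2 * c - 1 by rewrite sqr_sqrtr//; lra.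
have X0 : 0 <= X by exact: sqrtr_ge0.
have X1 : X <= 1 by rewrite -(@ler_pXn2r _ 2)// ?nnegrE ?ler01// expr1n X2; lra.
rewrite le_entropy_of//; last first.
  move=> an1; rewrite /binary_entropic /entropic (negbTE an1).
  by rewrite ltr_pwDl ?powR_ge0// powR_gt0//; lra.
apply: binary_entropic_le_lim => //; first by rewrite X0.
(* With N the norm and h that of the output, X^2 - x^2 = 2 (N - h)(N + h) <= 4 (N - h), hence the
   tolerance e/4. *)
move=> e e0; have [|rho drho rhoe] := norm12_adherent _ _ Phi (e / 4) m0 chan.
  by rewrite divr_gt0.
have [lam slam] := spec _ drho.
have [lam0 lam1 lam2 hsE] := purity _ _ drho slam.
have s2 := half_le _ lam1.
exists (Num.sqrt (2 * (\sum_i lam i ^+ 2) - 1)); split.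
- exact: sqrtr_ge0.
- by rewrite ler_wsqrtr//; lra.
- rewrite X2 sqr_sqrtr; last lra.
  rewrite -hsE /c.
  have h1 := norm12_ub _ _ _ _ chan drho.
  have h0 : 0 <= hs_norm (Phi rho) by exact: sqrtr_ge0.
  have : (norm12 Phi - hs_norm (Phi rho)) * (norm12 Phi + hs_norm (Phi rho)) <=
      (norm12 Phi - hs_norm (Phi rho)) * 2 by apply: ler_wpM2l; lra.
  lra.
- rewrite -sum_entropic_binary// -le_entropy_of//.
    by rewrite -renyiE; exact: Smin_le slam.
  by move=> an1; exact: entropic_sum_gt0.
Qed.
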